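(* Let $G$ be a continuous family groupoid and $Y$ be a $G$-space. Then the class of $G$-spaces $X$ over $Y$ is canonically identified with the class of $G*Y$-spaces.
   Context: **$C^{0,\infty}$ maps.** Let $k\ge 1$. For open $V_1,V_2\subset\mathbb{R}^k$, $C^\infty(V_1,V_2)$ carries the topology of uniform convergence on compact subsets of $V_1$ for all derivatives. Let $Y$ be a topological space and $q_1:Y\times\mathbb{R}^k\to Y$ the projection. Let $A_1,A_2\subset Y\times\mathbb{R}^k$ be open with $q_1(A_1)\subset q_1(A_2)$, and let $A_i^y=\{x\in\mathbb{R}^k:(y,x)\in A_i\}$. A continuous map $f:A_1\to A_2$ is fiber preserving if $f(\{y\}\times A_1^y)\subset\{y\}\times A_2^y$ for all $y\in q_1(A_1)$; then $f^y:A_1^y\to A_2^y$ is defined by $f(y,x)=(y,f^y(x))$. Such an $f$ belongs to $C^{0,\infty}(A_1,A_2)$ if, whenever $U_i\subset Y$, $V_i\subset\mathbb{R}^k$ are open with $U_i\times V_i\subset A_i$ ($i=1,2$) and $f(U_1\times V_1)\subset U_2\times V_2$, the map $y\mapsto f^y|_{V_1}$ is continuous from $U_1$ into $C^\infty(V_1,V_2)$. $\mathrm{Diff}^0(A_1,A_2)$ is the set of $f\in C^{0,\infty}(A_1,A_2)$ for which $f^{-1}$ exists and belongs to $C^{0,\infty}(A_2,A_1)$. **Continuous families.** A fiber space $(X,p)$ over $Y$ consists of locally compact Hausdorff spaces $X,Y$ and a continuous open surjection $p:X\to Y$; write $X^y=p^{-1}(\{y\})$. A continuous family (of manifolds) over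 $Y$ is a fiber space $(X,p)$ over $Y$ with a (maximal) atlas of charts $(U_\alpha,\phi_\alpha)$, where the $U_\alpha$ are open and cover $X$, such that (i) $\phi_\alpha$ is a homeomorphism of $U_\alpha$ onto an open subset of $Y\times\mathbb{R}^k$ with $q_1\circ\phi_\alpha=p|_{U_\alpha}$; (ii) $\phi_\beta\circ\phi_\alpha^{-1}\in\mathrm{Diff}^0(\phi_\alpha(U_\alpha\cap U_\beta),\phi_\beta(U_\alpha\cap U_\beta))$ for all $\alpha,\beta$. Each $X^y$ is then a smooth manifold. Write $U\sim p(U)\times W$ for a chart $(U,\phi)$ with $\phi(U)=p(U)\times W$, $W\subset\mathbb{R}^k$ open. **Morphisms.** Let $(X_1,p_1),(X_2,p_2)$ be continuous families over $Y_1,Y_2$ and $q:Y_1\to Y_2$ continuous. A continuous $f:X_1\to X_2$ with $p_2\circ f=q\circ p_1$ is a morphism with respect to $q$ if each restriction $f^y:X_1^y\to X_2^{q(y)}$ is $C^\infty$ and, given $x\in X_1$ and a chart $U_2\sim p_2(U_2)\times W_2$ containing $f(x)$, there is a chart $U_1\sim p_1(U_1)\times W_1$ with $x\in U_1$, $f(U_1)\subset U_2$, such that, in local coordinates $f(y,w_1)=(q(y),f^y(w_1))$, the map $y\mapsto f^y$ is continuous from $p_1(U_1)$ into $C^\infty(W_1,W_2)$. When $Y_1=Y_2$ and no $q$ is mentioned, $q$ is the identity. Isomorphisms are morphisms with an inverse morphism. **Groupoids.** A groupoid is a small category with inverses. A locally compact groupoid is a groupoid $G$ that is a second countable locally compact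 Hausdorff space with continuous multiplication and inversion; $r(x)=xx^{-1}$, $s(x)=x^{-1}x$, $G^0=r(G)=s(G)$ is the unit space; $xy$ is defined iff $s(x)=r(y)$. A locally compact groupoid $G$ is a continuous family groupoid if: (i) $(G,s)$ and $(G,r)$ are continuous families of manifolds over $G^0$; (ii) inversion $i:(G,s)\to(G,r)$, $i(x)=x^{-1}$, is an isomorphism of continuous families over $G^0$; (iii) multiplication $m:(G*G,t_1)\to(G,r)$ is a morphism with respect to $r:G\to G^0$, where $G*G=\{(x,y)\in G\times G:s(x)=r(y)\}$, $t_1(x,y)=x$, and $(G*G,t_1)$ is the continuous family over $G$ with charts: for each chart $(U,\phi)$ of $(G,r)$, $\phi(y)=(r(y),h(y))$, the set $\{(x,y)\in G*G:y\in U\}$ with the map $(x,y)\mapsto(x,h(y))$. **$G$-spaces.** Let $G$ be a locally compact groupoid with $r,s$ open, and let $(Y,p)$ be a fiber space over $G^0$. Put $G*Y=\{(g,y)\in G\times Y:s(g)=p(y)\}$ with the relative topology. $(Y,p)$ is a $G$-space if there is given a continuous map (action) $G*Y\to Y$, $(g,y)\mapsto gy$, such that $p(gy)=r(g)$, $g_1(g_2y)=(g_1g_2)y$ and $g^{-1}(gy)=y$ whenever these make sense. **The groupoid $G*Y$.** If $Y$ is a $G$-space, $G*Y$ is a locally compact groupoid with operations $(h,z)(g,g^{-1}z)=(hg,g^{-1}z)$ and $(g,y)^{-1}=(g^{-1},gy)$; its unit space $\{(p(y),y):y\in Y\}$ is identified with $Y$, so its source and range maps are $(g,y)\mapsto y$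 and $(g,y)\mapsto gy$. The notion of a $G*Y$-space is the notion of $G$-space above applied to the groupoid $G*Y$; thus a $G*Y$-space is a fiber space $(X,q)$ over $(G*Y)^0=Y$ with an action of $G*Y$. **$G$-spaces over $Y$.** Let $(Y,p)$ be a $G$-space. A $G$-space over $Y$ is a fiber space $(X,q)$ over $Y$ such that $(X,p\circ q)$ (a fiber space over $G^0$) is a $G$-space and $q(gx)=g\,q(x)$ for all $(g,x)\in G*X$. *)

(* Defs.v *)
From HB Require Import structures.
From mathcomp Require Import all_boot all_order all_algebra.
From mathcomp Require Import all_classical all_reals all_analysis.
Import numFieldNormedType.Exports.

Set Implicit Arguments.
Unset Strict Implicit.
Unset Printing Implicit Defensive.
Local Open Scope classical_set_scope.
Local Open Scope ring_scope.

(* [pderiv I f] is the iterated partial derivative of [f] along the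
   coordinate directions listed in [I]. *)
Fixpoint pderiv (R : realType) k (I : seq 'I_k) (f : 'rV[R]_k -> 'rV[R]_k) :=
  if I is i :: I' then
    (fun w => derive (pderiv I' f) w (delta_mx 0 i)) : 'rV[R]_k -> 'rV[R]_k
  else f.

Definition smooth_on (R : realType) k (V : set 'rV[R]_k)
    (f : 'rV[R]_k -> 'rV[R]_k) : Prop :=
  forall (I : seq 'I_k) w, V w ->
    {for w, continuous (pderiv I f)} /\
    forall i : 'I_k, derivable (pderiv I f) w (delta_mx 0 i).

(* Maps defined on an open subset of R^k are represented by total functions
   whose values outside that subset are irrelevant. *)
Definition in_Cinfty (R : realType) k (V W : set 'rV[R]_k)
    (f : 'rV[R]_k -> 'rV[R]_k) : Prop :=
  smooth_on V f /\ f @` V `<=` W.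

Definition all_pderiv (R : realType) k (V : set 'rV[R]_k)
    (f : 'rV[R]_k -> 'rV[R]_k) :
    {ptws seq 'I_k ->
      {family [set K | compact K /\ K `<=` V], 'rV[R]_k -> 'rV[R]_k}} :=
  fun I => pderiv I f.

(* The topology of C^oo(V, W): initial for the maps [pderiv I] into the
   functions with uniform convergence on the compact subsets of V. *)
Definition Cinfty_topology (R : realType) k (V : set 'rV[R]_k) :=
  initial_topology (@all_pderiv R k V).
HB.instance Definition _ (R : realType) k (V : set 'rV[R]_k) :=
  Topological.copy (Cinfty_topology V) (initial_topology (@all_pderiv R k V)).

Definition continuous_into_Cinfty (R : realType) k (Y : topologicalType)
    (U : set Y) (V W : set 'rV[R]_k) (F : Y -> 'rV[R]_k -> 'rV[R]_k) : Prop :=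
  (forall y, U y -> in_Cinfty V W (F y)) /\
  {within U, continuous (F : Y -> Cinfty_topology V)}.

Section C0infty.
Variables (R : realType) (k : nat) (Y : topologicalType).
Implicit Types (A : set (Y * 'rV[R]_k)) (f : Y * 'rV[R]_k -> Y * 'rV[R]_k).

Definition fiber_preserving A1 A2 f : Prop :=
  forall z, A1 z -> (f z).1 = z.1 /\ A2 (f z).

Definition fiber_map f (y : Y) (w : 'rV[R]_k) : 'rV[R]_k := (f (y, w)).2.

Definition C0infty A1 A2 f : Prop :=
  [/\ {within A1, continuous f},
      fiber_preserving A1 A2 f &
      forall (U1 U2 : set Y) (V1 V2 : set 'rV[R]_k),
        open U1 -> open V1 -> open U2 -> open V2 ->
        U1 `*` V1 `<=` A1 -> U2 `*` V2 `<=` A2 ->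
        f @` (U1 `*` V1) `<=` U2 `*` V2 ->
        continuous_into_Cinfty U1 V1 V2 (fiber_map f)].

Definition Diff0 A1 A2 f : Prop :=
  C0infty A1 A2 f /\
  exists g, [/\ C0infty A2 A1 g,
    (forall z, A1 z -> g (f z) = z) & (forall z, A2 z -> f (g z) = z)].

End C0infty.

Definition lc_hausdorff (T : topologicalType) : Prop :=
  locally_compact [set: T] /\ hausdorff_space T.

Definition is_open_map (X Y : topologicalType) (p : X -> Y) : Prop :=
  forall U : set X, open U -> open (p @` U).

Definition is_fiber_space (X Y : topologicalType) (p : X -> Y) : Prop :=
  [/\ lc_hausdorff X, lc_hausdorff Y, continuous p, is_open_map p &
      set_surj [set: X] [set: Y] p].

Record fiberSpace (B : topologicalType) := FiberSpace {
  fs_total :> topologicalType;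
  fs_proj : fs_total -> B;
  fs_fiber : is_fiber_space fs_proj }.

(* Only the values of [chart_map] on [chart_dom], and those of its inverse
   [chart_inv] on the image of [chart_dom], are meaningful. *)
Record chart (R : realType) (k : nat) (X Y : topologicalType) := Chart {
  chart_dom : set X;
  chart_map : X -> Y * 'rV[R]_k;
  chart_inv : Y * 'rV[R]_k -> X }.

Section Charts.
Variables (R : realType) (k : nat) (X Y : topologicalType) (p : X -> Y).
Implicit Types (c d : chart R k X Y) (A : set (chart R k X Y)).

Definition chart_img c : set (Y * 'rV[R]_k) := chart_map c @` chart_dom c.

Definition is_chart c : Prop :=
  [/\ open (chart_dom c) /\ open (chart_img c),
      {within chart_dom c, continuous (chart_map c)},
      {within chart_img c, continuous (chart_inv c)},
      (forall x, chart_dom c x -> chart_inv c (chart_map c x) = x) &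
      (forall x, chart_dom c x -> (chart_map c x).1 = p x)].

Definition compatible c d : Prop :=
  Diff0 (chart_map c @` (chart_dom c `&` chart_dom d))
        (chart_map d @` (chart_dom c `&` chart_dom d))
        (chart_map d \o chart_inv c).

Definition generated_atlas A : set (chart R k X Y) :=
  [set c | is_chart c /\ forall d, A d -> compatible c d /\ compatible d c].

Definition is_maximal_atlas A : Prop :=
  [/\ (forall c, A c -> is_chart c),
      (forall x, exists2 c, A c & chart_dom c x),
      (forall c d, A c -> A d -> compatible c d) &
      generated_atlas A `<=` A].

Definition is_continuous_family A : Prop :=
  is_fiber_space p /\ is_maximal_atlas A.

(* The relation U ~ p(U) x W. *)
Definition product_chart c (W : set 'rV[R]_k) : Prop :=
  open W /\ chart_img c = (p @` chart_dom c) `*` W.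

End Charts.

Section Morphisms.
Variables (R : realType) (k : nat).

Definition local_expr (X1 Y1 X2 Y2 : topologicalType)
    (c1 : chart R k X1 Y1) (c2 : chart R k X2 Y2) (f : X1 -> X2)
    (y : Y1) (w : 'rV[R]_k) : 'rV[R]_k :=
  (chart_map c2 (f (chart_inv c1 (y, w)))).2.

(* The second clause says that every restriction of [f] to a fiber is smooth
   as a map between manifolds. *)
Definition is_morphism (X1 Y1 X2 Y2 : topologicalType)
    (p1 : X1 -> Y1) (A1 : set (chart R k X1 Y1))
    (p2 : X2 -> Y2) (A2 : set (chart R k X2 Y2))
    (q : Y1 -> Y2) (f : X1 -> X2) : Prop :=
  [/\ continuous f /\ (forall x, p2 (f x) = q (p1 x)),
      (forall y c1 c2, A1 c1 -> A2 c2 ->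
        smooth_on [set w | chart_img c1 (y, w) /\
                           chart_dom c2 (f (chart_inv c1 (y, w)))]
          (local_expr c1 c2 f y)) &
      (forall x c2 W2, A2 c2 -> product_chart p2 c2 W2 ->
        chart_dom c2 (f x) ->
        exists c1 W1,
          [/\ A1 c1 /\ product_chart p1 c1 W1, chart_dom c1 x,
              f @` chart_dom c1 `<=` chart_dom c2 &
              continuous_into_Cinfty (p1 @` chart_dom c1) W1 W2
                (local_expr c1 c2 f)])].

Definition is_isomorphism (X1 X2 Y : topologicalType)
    (p1 : X1 -> Y) (A1 : set (chart R k X1 Y))
    (p2 : X2 -> Y) (A2 : set (chart R k X2 Y)) (f : X1 -> X2) : Prop :=
  is_morphism p1 A1 p2 A2 id f /\
  exists g, [/\ is_morphism p2 A2 p1 A1 id g, cancel f g & cancel g f].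

End Morphisms.

(* The fibered product, with the topology induced by the product. *)
Definition fibprod (A B C : Type) (f : A -> C) (g : B -> C) : set (A * B) :=
  [set z | f z.1 = g z.2].

Lemma fibprodP (A B C : Type) (f : A -> C) (g : B -> C) (z : fibprod f g) :
  f (\val z).1 = g (\val z).2.
Proof. exact: (set_valP z). Qed.

(* A locally compact groupoid with open range and source maps, as a small
   category with inverses: [gobj] is the unit space, embedded in the space
   [garr] of arrows by [gunit] (continuity of [gunit] and [gsrc] makes it a
   homeomorphism onto its image), and [gmul g h] is defined when
   [gsrc g = grng h]. Second countability is not included: the groupoid G * Y
   below is second countable only when Y is. *)
Record lcGroupoid := LcGroupoid {
  gobj : topologicalType;
  garr : topologicalType;
  gunit : gobj -> garr;
  gsrc : garr -> gobj;
  grng : garr -> gobj;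
  ginv : garr -> garr;
  gmul : forall g h : garr, gsrc g = grng h -> garr;
  gsrc_unit : forall a, gsrc (gunit a) = a;
  grng_unit : forall a, grng (gunit a) = a;
  gsrc_inv : forall g, gsrc (ginv g) = grng g;
  grng_inv : forall g, grng (ginv g) = gsrc g;
  gsrc_mul : forall g h (e : gsrc g = grng h), gsrc (gmul e) = gsrc h;
  grng_mul : forall g h (e : gsrc g = grng h), grng (gmul e) = grng g;
  gmulA : forall f g h (e1 : gsrc f = grng g) (e2 : gsrc g = grng h)
    (e3 : gsrc (gmul e1) = grng h) (e4 : gsrc f = grng (gmul e2)),
    gmul e3 = gmul e4;
  gmul1g : forall g (e : gsrc (gunit (grng g)) = grng g), gmul e = g;
  gmulg1 : forall g (e : gsrc g = grng (gunit (gsrc g))), gmul e = g;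
  gmulgV : forall g (e : gsrc g = grng (ginv g)), gmul e = gunit (grng g);
  gmulVg : forall g (e : gsrc (ginv g) = grng g), gmul e = gunit (gsrc g);
  garr_lcH : lc_hausdorff garr;
  gunit_continuous : continuous gunit;
  gsrc_continuous : continuous gsrc;
  grng_continuous : continuous grng;
  ginv_continuous : continuous ginv;
  gmul_continuous :
    continuous (fun z : fibprod gsrc grng => gmul (fibprodP z));
  gsrc_open : is_open_map gsrc;
  grng_open : is_open_map grng }.

(* The atlas of (G * G, t1) over G generated by the charts
   (x, y) |-> (x, h y), for the charts y |-> (r y, h y) of an atlas of
   (G, r). *)
Definition composable_atlas (R : realType) k (G : lcGroupoid)
    (A : set (chart R k (garr G) (gobj G))) :
    set (chart R k (fibprod (@gsrc G) (@grng G)) (garr G)) :=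
  let t1 := fun z : fibprod (@gsrc G) (@grng G) => (\val z).1 in
  generated_atlas t1
    [set c | is_chart t1 c /\
      exists2 d, A d &
        chart_dom c = [set z | chart_dom d (\val z).2] /\
        forall z, chart_dom c z ->
          chart_map c z = ((\val z).1, (chart_map d (\val z).2).2)].

Record contFamilyGroupoid (R : realType) (k : nat) := ContFamilyGroupoid {
  cfg_groupoid :> lcGroupoid;
  cfg_countable : @second_countable (garr cfg_groupoid);
  cfg_src_atlas : set (chart R k (garr cfg_groupoid) (gobj cfg_groupoid));
  cfg_rng_atlas : set (chart R k (garr cfg_groupoid) (gobj cfg_groupoid));
  cfg_src_family : is_continuous_family (@gsrc cfg_groupoid) cfg_src_atlas;
  cfg_rng_family : is_continuous_family (@grng cfg_groupoid) cfg_rng_atlas;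
  cfg_inv_iso :
    is_isomorphism (@gsrc cfg_groupoid) cfg_src_atlas
                   (@grng cfg_groupoid) cfg_rng_atlas (@ginv cfg_groupoid);
  cfg_mul_morphism :
    is_morphism
      (fun z : fibprod (@gsrc cfg_groupoid) (@grng cfg_groupoid) => (\val z).1)
      (composable_atlas cfg_rng_atlas)
      (@grng cfg_groupoid) cfg_rng_atlas (@grng cfg_groupoid)
      (fun z : fibprod (@gsrc cfg_groupoid) (@grng cfg_groupoid) =>
         gmul (fibprodP z)) }.

Record groupoid_action (G : lcGroupoid) (X : fiberSpace (gobj G)) := Action {
  act : forall (g : garr G) (x : X), gsrc g = fs_proj x -> X;
  act_proj : forall g x (e : gsrc g = fs_proj x),
    fs_proj (act e) = grng g;
  act_mul : forall g1 g2 x (e12 : gsrc g1 = grng g2)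
    (e2 : gsrc g2 = fs_proj x) (e1 : gsrc g1 = fs_proj (act e2))
    (e : gsrc (gmul e12) = fs_proj x), act e1 = act e;
  act_inv : forall g x (e : gsrc g = fs_proj x)
    (e' : gsrc (ginv g) = fs_proj (act e)), act e' = x;
  act_continuous :
    continuous (fun z : fibprod (@gsrc G) (@fs_proj _ X) => act (fibprodP z)) }.

Record gspace (G : lcGroupoid) := GSpace {
  gs_fs :> fiberSpace (gobj G);
  gs_act : groupoid_action gs_fs }.

Lemma is_fiber_space_comp (X Y Z : topologicalType) (q : X -> Y) (p : Y -> Z) :
  is_fiber_space q -> is_fiber_space p -> is_fiber_space (p \o q).
Proof.
move=> [lX _ cq oq sq] [_ lZ cp op sp]; split => //.
- by move=> x; apply: continuous_comp; [exact: cq|exact: cp].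
- by move=> U oU; rewrite -image_comp; apply: op; exact: oq.
- move=> z _; have [y _ <-] := sp z I; have [x _ <-] := sq y I.
  by exists x.
Qed.

Definition fs_comp (B : topologicalType) (Y : fiberSpace B)
    (X : fiberSpace Y) : fiberSpace B :=
  FiberSpace (is_fiber_space_comp (fs_fiber X) (fs_fiber Y)).

Definition equivariant_proj (G : lcGroupoid) (Y : gspace G) (X : fiberSpace Y)
    (a : groupoid_action (fs_comp X)) : Prop :=
  forall (g : garr G) (x : X) (e : gsrc g = @fs_proj _ Y (@fs_proj _ X x)),
    @fs_proj _ X (act a (x := x) e) = act (gs_act Y) e.

Record gspace_over (G : lcGroupoid) (Y : gspace G) := GSpaceOver {
  gso_fs :> fiberSpace Y;
  gso_act : groupoid_action (fs_comp gso_fs);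
  gso_equivariant : equivariant_proj gso_act }.

Section FiberedProducts.
Variables A B C : topologicalType.

Lemma fibprod_val_continuous (f : A -> C) (g : B -> C) :
  continuous (fun z : fibprod f g => \val z).
Proof. exact: initial_continuous. Qed.

Lemma fibprod_fst_continuous (f : A -> C) (g : B -> C) :
  continuous (fun z : fibprod f g => (\val z).1).
Proof.
move=> z; apply: (@continuous_comp _ _ _ (fun z : fibprod f g => \val z) fst).
  exact: fibprod_val_continuous.
exact: cvg_fst.
Qed.

Lemma fibprod_snd_continuous (f : A -> C) (g : B -> C) :
  continuous (fun z : fibprod f g => (\val z).2).
Proof.
move=> z; apply: (@continuous_comp _ _ _ (fun z : fibprod f g => \val z) snd).
  exact: fibprod_val_continuous.
exact: cvg_snd.
Qed.

Lemma continuous_fibprod (T : topologicalType) (f : A -> C) (g : B -> C)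
    (h : T -> fibprod f g) :
  continuous (fun t => (\val (h t)).1) -> continuous (fun t => (\val (h t)).2) ->
  continuous h.
Proof.
move=> h1 h2; apply: (@continuous_comp_initial _ _ _ _ h) => t.
rewrite (_ : _ \o h = fun t => ((\val (h t)).1, (\val (h t)).2)).
  by apply: cvg_pair; [exact: h1|exact: h2].
by apply/funext => u; rewrite [LHS]surjective_pairing.
Qed.

Lemma hausdorff_fibprod (f : A -> C) (g : B -> C) :
  hausdorff_space A -> hausdorff_space B -> hausdorff_space (fibprod f g).
Proof.
move=> hA hB z w zw; apply/val_inj.
have pz (T : topologicalType) (u : fibprod f g -> T) :
    continuous u -> cluster (nbhs (u z)) (u w).
  move=> cu P Q /cu Pz /cu Qw.
  by have [t [Pt Qt]] := zw _ _ Pz Qw; exists (u t).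
have e1 := hA _ _ (pz _ _ (@fibprod_fst_continuous f g)).
have e2 := hB _ _ (pz _ _ (@fibprod_snd_continuous f g)).
by rewrite [LHS]surjective_pairing [RHS]surjective_pairing e1 e2.
Qed.

Lemma fibprod_closed (f : A -> C) (g : B -> C) :
  continuous f -> continuous g -> hausdorff_space C -> closed (fibprod f g).
Proof.
move=> cf cg hC [a b] cl; apply: hC => P Q /cf Pa /cg Qb.
have [[a' b'] [/= e [Pa' Qb']]] :
    fibprod f g `&` [set z | P (f z.1) /\ Q (g z.2)] !=set0.
  by apply: cl; exists (f @^-1` P, g @^-1` Q).
by exists (f a'); split => //; rewrite e.
Qed.

Lemma fibprod_lc_hausdorff (f : A -> C) (g : B -> C) :
  continuous f -> continuous g -> hausdorff_space C ->
  lc_hausdorff A -> lc_hausdorff B -> lc_hausdorff (fibprod f g).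
Proof.
move=> cf cg hC [lA hA] [lB hB]; split; last exact: hausdorff_fibprod.
move=> z _; rewrite within_interior ?interiorT //.
have := lA (\val z).1 I; rewrite within_interior ?interiorT // => -[K nK [cK clK]].
have := lB (\val z).2 I; rewrite within_interior ?interiorT // => -[L nL [cL clL]].
exists ((fun z : fibprod f g => \val z) @^-1` (K `*` L)).
  by apply: fibprod_val_continuous; exists (K, L).
split; last first.
  rewrite (_ : _ @^-1` _ = ((fun z : fibprod f g => (\val z).1) @^-1` K) `&`
                          ((fun z : fibprod f g => (\val z).2) @^-1` L)) //.
  apply: closedI; apply: closed_comp => // t _.
    exact: fibprod_fst_continuous.
  exact: fibprod_snd_continuous.
move=> F FF FKL.
have [q [KLq clq]] := compact_setX cK cL
  (fmap_proper_filter (fun z : fibprod f g => \val z) FF) FKL.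
have qA : fibprod f g q.
  apply: (fibprod_closed cf cg hC) => Q nQ.
  have [|t [St Qt]] := clq (fibprod f g) Q _ nQ; last by exists t.
  by apply: (@filterS _ F _ setT) => [t _|]; [exact: set_valP|exact: filterT].
exists (SigSub (mem_set qA)); split; first exact: KLq.
move=> P Q FP [_ [[W oW <-] Wq WQ]].
have [|t [[u Pu <-] Wu]] := clq ((fun u : fibprod f g => \val u) @` P) W _ (open_nbhs_nbhs (conj oW Wq)).
  by apply: (@filterS _ F _ P) FP => u Pu; exists u.
by exists u; split => //; exact: WQ.
Qed.

Lemma fibprod_snd_open (f : A -> C) (g : B -> C) :
  is_open_map f -> continuous g ->
  is_open_map (fun z : fibprod f g => (\val z).2).
Proof.
move=> of_ cg _ [W oW <-]; rewrite openE => _ [z Wz <-].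
have : nbhs (\val z) W by exact: open_nbhs_nbhs.
case=> -[P Q] /= [nP nQ] PQW.
move: nP; rewrite nbhsE => -[P' [oP' P'z] P'P].
have ng : nbhs (\val z).2 (g @^-1` (f @` P')).
  apply: cg; apply: open_nbhs_nbhs; split; first exact: of_.
  by exists (\val z).1 => //; exact: fibprodP.
apply: filterS (filterI nQ ng) => b [Qb [a P'a e]].
exists (SigSub (mem_set (e : fibprod f g (a, b)))) => //=.
by apply: PQW; split => //; exact: P'P.
Qed.

End FiberedProducts.

Section SemidirectGroupoid.
Variables (G : lcGroupoid) (Y : gspace G).

Let p : Y -> gobj G := @fs_proj _ Y.
Let actY := act (gs_act Y).

Lemma proj_act (g : garr G) (y : Y) (e : gsrc g = p y) : p (actY e) = grng g.
Proof. exact: act_proj. Qed.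

Lemma act_eq (g h : garr G) (y z : Y) (e : gsrc g = p y) (e' : gsrc h = p z) :
  g = h -> y = z -> actY e = actY e'.
Proof.
by move=> gh yz; subst h z; congr act; exact: Prop_irrelevance.
Qed.


Lemma act_unit (y : Y) (e : gsrc (gunit (p y)) = p y) : actY e = y.
Proof.
set u := gunit (p y).
have e1 : gsrc (ginv u) = p (actY e) by rewrite proj_act gsrc_inv.
have e12 : gsrc (ginv u) = grng u by rewrite gsrc_inv.
have e3 : gsrc (gmul e12) = p y by rewrite gsrc_mul.
have gu : gmul e12 = u by rewrite gmulVg /u gsrc_unit.
have h : actY e1 = actY e3 by exact: act_mul.
rewrite -[RHS](act_inv e1) -/actY [in RHS]h; exact/esym/act_eq.
Qed.

(* The groupoid G * Y, with unit space Y: the unit (p y, y) is identified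
   with y. *)
Definition star_arr : topologicalType := fibprod (@gsrc G) p.

Definition star (g : garr G) (y : Y) (e : gsrc g = p y) : star_arr :=
  SigSub (mem_set (e : fibprod (@gsrc G) p (g, y))).

Definition star_src (z : star_arr) : Y := (\val z).2.

Definition star_rng (z : star_arr) : Y := actY (fibprodP z).

Definition star_unit (y : Y) : star_arr := star (gsrc_unit (p y)).

Lemma star_inv_subproof (z : star_arr) :
  gsrc (ginv (\val z).1) = p (star_rng z).
Proof. by rewrite gsrc_inv proj_act. Qed.

Definition star_inv (z : star_arr) : star_arr := star (star_inv_subproof z).

Lemma star_mul_subproof1 (z w : star_arr) (e : star_src z = star_rng w) :
  gsrc (\val z).1 = grng (\val w).1.
Proof.
by rewrite (fibprodP z) -[(\val z).2]/(star_src z) e proj_act.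
Qed.

Lemma star_mul_subproof2 (z w : star_arr) (e : star_src z = star_rng w) :
  gsrc (gmul (star_mul_subproof1 e)) = p (star_src w).
Proof. by rewrite gsrc_mul; exact: fibprodP. Qed.

(* (h, z) (g, y) = (h g, y) whenever z = g y *)
Definition star_mul (z w : star_arr) (e : star_src z = star_rng w) : star_arr :=
  star (star_mul_subproof2 e).

Lemma star_eq (z w : star_arr) :
  (\val z).1 = (\val w).1 -> (\val z).2 = (\val w).2 -> z = w.
Proof.
move=> e1 e2; apply/val_inj.
by rewrite [LHS]surjective_pairing [RHS]surjective_pairing e1 e2.
Qed.

Lemma gmul_eq (g g' h h' : garr G) (e : gsrc g = grng h)
    (e' : gsrc g' = grng h') : g = g' -> h = h' -> gmul e = gmul e'.
Proof.
by move=> gg hh; subst g' h'; congr gmul; exact: Prop_irrelevance.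
Qed.

Lemma star_rng_continuous : continuous star_rng.
Proof. exact: act_continuous. Qed.

Lemma star_inv_continuous : continuous star_inv.
Proof.
apply: continuous_fibprod => z /=; last exact: star_rng_continuous.
apply: (@continuous_comp _ _ _ (fun z : star_arr => (\val z).1) (@ginv G)).
  exact: fibprod_fst_continuous.
exact: ginv_continuous.
Qed.

Lemma star_invK : involutive star_inv.
Proof.
move=> z; apply: star_eq => /=; last exact: act_inv.
set g := (\val z).1.
have e : gsrc (ginv (ginv g)) = grng (ginv g) by rewrite gsrc_inv.
have e' : gsrc (ginv g) = grng g by rewrite gsrc_inv.
have e1 : gsrc (gmul e) = grng g by rewrite gsrc_mul gsrc_inv.
have e2 : gsrc (ginv (ginv g)) = grng (gmul e').
  by rewrite grng_mul gsrc_inv.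
have := gmulA e1 e2.
have e3 : gsrc (gunit (grng g)) = grng g by rewrite gsrc_unit.
have e4 : gsrc (ginv (ginv g)) = grng (gunit (gsrc (ginv (ginv g)))).
  by rewrite grng_unit.
rewrite (@gmul_eq _ _ _ _ e1 e3) ?gmulVg ?gsrc_inv // gmul1g.
rewrite (@gmul_eq _ _ _ _ e2 e4) ?gmulVg ?gsrc_inv ?grng_inv //.
by rewrite gmulg1.
Qed.

Lemma star_src_inv z : star_src (star_inv z) = star_rng z.
Proof. by []. Qed.

Lemma star_rng_inv z : star_rng (star_inv z) = star_src z.
Proof. by rewrite -star_src_inv star_invK. Qed.

Lemma star_rng_mul z w (e : star_src z = star_rng w) :
  star_rng (star_mul e) = star_rng z.
Proof.
have e1 : gsrc (\val z).1 = p (actY (fibprodP w)).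
  by rewrite (fibprodP z) -[(\val z).2]/(star_src z) e.
transitivity (actY e1).
  by symmetry; apply: act_mul.
by apply: act_eq => //; symmetry.
Qed.

Lemma star_mul_continuous :
  continuous (fun z : fibprod star_src star_rng => star_mul (fibprodP z)).
Proof.
apply: continuous_fibprod => /=; last first.
  move=> z; apply: (@continuous_comp _ _ _
    (fun z : fibprod star_src star_rng => (\val z).2) star_src).
    exact: fibprod_snd_continuous.
  exact: fibprod_snd_continuous.
pose h (z : fibprod star_src star_rng) : fibprod (@gsrc G) (@grng G) :=
  SigSub (mem_set (star_mul_subproof1 (fibprodP z) :
    fibprod (@gsrc G) (@grng G) ((\val (\val z).1).1, (\val (\val z).2).1))).
have ch : continuous h.
  apply: continuous_fibprod => z /=.
    apply: (@continuous_comp _ _ _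
      (fun z : fibprod star_src star_rng => (\val z).1)
      (fun z : star_arr => (\val z).1)).
      exact: fibprod_fst_continuous.
    exact: fibprod_fst_continuous.
  apply: (@continuous_comp _ _ _
    (fun z : fibprod star_src star_rng => (\val z).2)
    (fun z : star_arr => (\val z).1)).
    exact: fibprod_snd_continuous.
  exact: fibprod_fst_continuous.
move=> z; rewrite (_ : (fun z => _) =
  (fun z : fibprod (@gsrc G) (@grng G) => gmul (fibprodP z)) \o h).
  by apply: continuous_comp; [exact: ch|exact: gmul_continuous].
by apply/funext => t /=; apply: gmul_eq.
Qed.

Lemma star_src_open : is_open_map star_src.
Proof.
apply: fibprod_snd_open; first exact: gsrc_open.
by have [] := fs_fiber Y.
Qed.

Lemma star_rng_open : is_open_map star_rng.
Proof.
move=> U oU; rewrite (_ : _ @` U = star_src @` (star_inv @^-1` U)).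
  by apply: star_src_open; apply: open_comp => // z _; exact: star_inv_continuous.
apply/seteqP; split => [_ [z Uz <-]|_ [z Uz <-]].
  by exists (star_inv z) => //=; rewrite star_invK.
by exists (star_inv z) => //; rewrite star_rng_inv.
Qed.

Lemma star_unit_continuous : continuous star_unit.
Proof.
apply: continuous_fibprod => y /=; last exact: cvg_id.
apply: (@continuous_comp _ _ _ p (@gunit G)); last exact: gunit_continuous.
by have [_ _ cp _ _] := fs_fiber Y; exact: cp.
Qed.

Lemma star_arr_lcH : lc_hausdorff star_arr.
Proof.
have [lY [_ hB] cp _ _] := fs_fiber Y.
apply: fibprod_lc_hausdorff => //; first exact: gsrc_continuous.
exact: garr_lcH.
Qed.

Definition star_groupoid : lcGroupoid.
Proof.
refine (@LcGroupoid Y star_arr star_unit star_src star_rng star_inv star_mul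
  _ _ star_src_inv star_rng_inv _ star_rng_mul _ _ _ _ _ star_arr_lcH
  star_unit_continuous _ star_rng_continuous star_inv_continuous
  star_mul_continuous star_src_open star_rng_open).
- by [].
- by move=> y; exact: act_unit.
- by [].
- move=> f g h e1 e2 e3 e4; apply: star_eq => //=.
  have d3 : gsrc (gmul (star_mul_subproof1 e1)) = grng (\val h).1.
    by rewrite gsrc_mul; exact: star_mul_subproof1.
  have d4 : gsrc (\val f).1 = grng (gmul (star_mul_subproof1 e2)).
    by rewrite grng_mul; exact: star_mul_subproof1.
  rewrite (@gmul_eq _ _ _ _ _ d3) // (gmulA d3 d4).
  exact: gmul_eq.
- move=> g e; apply: star_eq => //=.
  have d : gsrc (gunit (grng (\val g).1)) = grng (\val g).1.
    by rewrite gsrc_unit.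
  by rewrite -[RHS](gmul1g d); apply: gmul_eq => //; rewrite proj_act.
- move=> g e; apply: star_eq => //=.
  have d : gsrc (\val g).1 = grng (gunit (gsrc (\val g).1)).
    by rewrite grng_unit.
  by rewrite -[RHS](gmulg1 d); apply: gmul_eq => //; rewrite (fibprodP g).
- move=> g e; apply: star_eq => //=.
  by rewrite gmulgV proj_act.
- move=> g e; apply: star_eq => //=.
  by rewrite gmulVg (fibprodP g).
- exact: fibprod_snd_continuous.
Defined.

End SemidirectGroupoid.

(* Main.v *)
Require Import Defs.
From mathcomp Require Import all_boot all_order all_algebra.
From mathcomp Require Import all_classical all_reals all_analysis.

(** A point of (G * Y) * X is a triple ((g, y), x) with s(g) = p(y) and
    y = q(x).  The middle component is determined by x, so this space is
    G * X, where X is fibered over the units of G by p o q.  An action of G * Y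
    on X and an action of G on X are therefore maps on the same domain, related
    by (g, y) x = g x.

    Under this correspondence the axioms match, except at the projections: an
    action of G * Y satisfies q((g, y) x) = r(g, y) = g y, that is
    q(g x) = g q(x).  This is exactly the equivariance of q, and the
    condition p(q(g x)) = r(g) on an action of G follows from it.  The two
    directions are [star_action] and [action_of_star] below; [action_ext]
    reduces the fact that they are mutually inverse to an equality of
    underlying maps. *)

Set Implicit Arguments.
Unset Strict Implicit.
Unset Printing Implicit Defensive.
Local Open Scope classical_set_scope.

Lemma action_ext (G : lcGroupoid) (X : fiberSpace (gobj G))
    (a b : groupoid_action X) :
  (forall g x (e : gsrc g = fs_proj x), act a e = act b e) -> a = b.
Proof.
case: a b => f p1 m1 i1 c1 [f' p2 m2 i2 c2] /= ff'.
have ff : f = f'.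
  by apply: functional_extensionality_dep => g;
     apply: functional_extensionality_dep => x; apply/funext => e; exact: ff'.
by subst f'; congr Action; exact: Prop_irrelevance.
Qed.

Lemma gspace_over_ext (G : lcGroupoid) (Y : gspace G) (X : fiberSpace Y)
    (a b : groupoid_action (fs_comp X)) (ea : equivariant_proj a)
    (eb : equivariant_proj b) :
  a = b -> GSpaceOver ea = GSpaceOver eb.
Proof. by move=> ab; subst b; congr GSpaceOver; exact: Prop_irrelevance. Qed.

Lemma action_eq (G : lcGroupoid) (X : fiberSpace (gobj G))
    (a : groupoid_action X) (g h : garr G) (x z : X)
    (e : gsrc g = fs_proj x) (e' : gsrc h = fs_proj z) :
  g = h -> x = z -> act a e = act a e'.
Proof. exact: (@act_eq _ (GSpace a)). Qed.

Section Correspondence.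
Variables (G : lcGroupoid) (Y : gspace G).

Section StarAction.
Variable X : gspace_over Y.

Lemma star_act_subproof (z : star_arr Y) (x : X) (e : star_src z = fs_proj x) :
  gsrc (\val z).1 = @fs_proj _ (fs_comp (gso_fs X)) x.
Proof. by rewrite (fibprodP z) /= -e. Qed.

Definition star_act (z : star_arr Y) (x : X) (e : star_src z = fs_proj x) : X :=
  act (gso_act X) (star_act_subproof e).

(** The range of (g, y) is g y with y = q(x), so this is the equivariance of
    q. *)
Lemma star_act_proj z x (e : star_src z = fs_proj x) :
  fs_proj (star_act e) = star_rng z.
Proof.
rewrite /star_act (@gso_equivariant _ _ X) /star_rng.
by apply: act_eq => //; rewrite -e.
Qed.

Lemma star_act_mul z w x (ezw : star_src z = star_rng w)
    (ew : star_src w = fs_proj x) (ez : star_src z = fs_proj (star_act ew))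
    (e : star_src (star_mul ezw) = fs_proj x) :
  star_act ez = star_act e.
Proof.
have e12 := star_mul_subproof1 ezw.
have e3 : gsrc (gmul e12) = @fs_proj _ (fs_comp (gso_fs X)) x.
  by rewrite gsrc_mul; exact: star_act_subproof.
transitivity (act (gso_act X) e3).
  exact: (@act_mul _ _ (gso_act X) _ _ _ e12 (star_act_subproof ew)).
rewrite /star_act; apply: (action_eq (gso_act X)) => //=.
exact: gmul_eq.
Qed.

Lemma star_act_inv z x (e : star_src z = fs_proj x)
    (e' : star_src (star_inv z) = fs_proj (star_act e)) :
  star_act e' = x.
Proof.
exact: (@act_inv _ _ (gso_act X) _ _ (star_act_subproof e)).
Qed.

(** The action factors through ((g, y), x) |-> (g, x), which is continuous
    from (G * Y) * X to G * X. *)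
Lemma star_act_continuous :
  continuous (fun t : fibprod (@star_src _ Y) (@fs_proj _ X) =>
    star_act (fibprodP t)).
Proof.
pose h (t : fibprod (@star_src _ Y) (@fs_proj _ X)) :
    fibprod (@gsrc G) (@fs_proj _ (fs_comp (gso_fs X))) :=
  SigSub (mem_set (star_act_subproof (fibprodP t) :
    fibprod (@gsrc G) (@fs_proj _ (fs_comp (gso_fs X)))
      ((\val (\val t).1).1, (\val t).2))).
have ch : continuous h.
  apply: continuous_fibprod => t /=; last exact: fibprod_snd_continuous.
  apply: (@continuous_comp _ _ _
    (fun t : fibprod (@star_src _ Y) (@fs_proj _ X) => (\val t).1)
    (fun z : star_arr Y => (\val z).1)).
    exact: fibprod_fst_continuous.
  exact: fibprod_fst_continuous.
move=> t; rewrite (_ : (fun t => _) =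
  (fun u : fibprod (@gsrc G) (@fs_proj _ (fs_comp (gso_fs X))) =>
     act (gso_act X) (fibprodP u)) \o h).
  by apply: continuous_comp; [exact: ch|exact: act_continuous].
by apply/funext => u /=; exact: (action_eq (gso_act X)).
Qed.

Definition star_action : @groupoid_action (star_groupoid Y) (gso_fs X) :=
  @Action (star_groupoid Y) (gso_fs X) star_act star_act_proj star_act_mul
    star_act_inv star_act_continuous.

End StarAction.

Section ActionOfStar.
Variables (X : fiberSpace Y) (a : @groupoid_action (star_groupoid Y) X).

Let pq : X -> gobj G := @fs_proj _ (fs_comp X).

(** The arrow of G * Y by which g acts on x is (g, q(x)). *)
Definition unstar_act (g : garr G) (x : X) (e : gsrc g = pq x) : X :=
  @act (star_groupoid Y) X a (@star G Y g (fs_proj x) e) x erefl.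

Lemma unstar_act_equivariant g x (e : gsrc g = pq x) :
  fs_proj (unstar_act e) = act (gs_act Y) (x := fs_proj x) e.
Proof. by rewrite /unstar_act (@act_proj (star_groupoid Y) X a); exact: act_eq. Qed.

Lemma unstar_act_proj g x (e : gsrc g = pq x) : pq (unstar_act e) = grng g.
Proof. by rewrite /pq /= unstar_act_equivariant (@act_proj G Y). Qed.

(** In G * Y, (g1, q(g2 x)) and (g2, q(x)) are composable because
    q(g2 x) = g2 q(x), with product (g1 g2, q(x)). *)
Lemma unstar_act_mul g1 g2 x (e12 : gsrc g1 = grng g2) (e2 : gsrc g2 = pq x)
    (e1 : gsrc g1 = pq (unstar_act e2)) (e : gsrc (gmul e12) = pq x) :
  unstar_act e1 = unstar_act e.
Proof.
have ezw : star_src (@star G Y _ _ e1) = star_rng (@star G Y _ _ e2).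
  by rewrite /star_src /= unstar_act_equivariant; exact: act_eq.
rewrite /unstar_act (@act_mul (star_groupoid Y) _ a _ _ _ ezw erefl erefl erefl).
by apply: (action_eq a) => //; apply: star_eq => //=; exact: gmul_eq.
Qed.

Lemma unstar_act_inv g x (e : gsrc g = pq x)
    (e' : gsrc (ginv g) = pq (unstar_act e)) :
  unstar_act e' = x.
Proof.
have e1 : @gsrc (star_groupoid Y) (star_inv (@star G Y _ _ e)) =
    fs_proj (unstar_act e).
  by rewrite unstar_act_equivariant; exact: act_eq.
rewrite -[RHS](@act_inv (star_groupoid Y) _ a (@star G Y _ _ e) x erefl e1).
by apply: (action_eq a) => //; apply: star_eq => //=; rewrite -e1.
Qed.

(** The action factors through (g, x) |-> ((g, q(x)), x), which is continuous
    because q is. *)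
Lemma unstar_act_continuous :
  continuous (fun t : fibprod (@gsrc G) pq => unstar_act (fibprodP t)).
Proof.
pose h (t : fibprod (@gsrc G) pq) : fibprod (@star_src _ Y) (@fs_proj _ X) :=
  SigSub (mem_set (erefl : fibprod (@star_src _ Y) (@fs_proj _ X)
    (@star G Y _ _ (fibprodP t), (\val t).2))).
have ch : continuous h.
  apply: continuous_fibprod => /=; last exact: fibprod_snd_continuous.
  apply: continuous_fibprod => t /=; first exact: fibprod_fst_continuous.
  apply: (@continuous_comp _ _ _
    (fun t : fibprod (@gsrc G) pq => (\val t).2) (@fs_proj _ X)).
    exact: fibprod_snd_continuous.
  by have [_ _ cq _ _] := fs_fiber X; exact: cq.
move=> t; rewrite (_ : (fun t => _) =
  (fun u : fibprod (@star_src _ Y) (@fs_proj _ X) =>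
     @act (star_groupoid Y) X a _ _ (fibprodP u)) \o h).
  apply: continuous_comp; first exact: ch.
  exact: (@act_continuous (star_groupoid Y)).
by apply/funext => u /=; exact: (action_eq a).
Qed.

Definition action_of_star : groupoid_action (fs_comp X) :=
  @Action G (fs_comp X) unstar_act unstar_act_proj unstar_act_mul
    unstar_act_inv unstar_act_continuous.

Definition gspace_over_of_star : gspace_over Y :=
  @GSpaceOver G Y X action_of_star unstar_act_equivariant.

End ActionOfStar.

Lemma star_actionK (X : gspace_over Y) :
  gspace_over_of_star (star_action X) = X.
Proof.
case: X => X a ea; apply: gspace_over_ext; apply: action_ext => g x e /=.
exact: (action_eq a).
Qed.

(** An arrow (g, y) of G * Y that acts on x has y = q(x), so it is the arrow
    (g, q(x)) of [unstar_act]. *)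
Lemma action_of_starK (X : fiberSpace Y)
    (a : @groupoid_action (star_groupoid Y) X) :
  star_action (gspace_over_of_star a) = a.
Proof.
apply: action_ext => z x e /=.
rewrite /unstar_act; apply: (action_eq a) => //.
by apply: star_eq => //=; rewrite -e.
Qed.

Lemma star_action_bijective :
  bijective (fun X : gspace_over Y =>
    @GSpace (star_groupoid Y) (gso_fs X) (star_action X)).
Proof.
exists (fun Z : gspace (star_groupoid Y) => gspace_over_of_star (gs_act Z)).
  exact: star_actionK.
by case=> X a /=; rewrite action_of_starK.
Qed.

End Correspondence.

Theorem theorem2 (R : realType) (k : nat) (k_gt0 : (0 < k)%N)
    (G : contFamilyGroupoid R k) (Y : gspace G) :
  exists Phi : forall X : gspace_over Y,
      @groupoid_action (star_groupoid Y) (gso_fs X),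
    bijective (fun X : gspace_over Y => @GSpace (star_groupoid Y) (gso_fs X) (Phi X)) /\
    forall (X : gspace_over Y) (g : garr G) (y : Y) (x : X)
      (e : gsrc g = fs_proj y)
      (e1 : @gsrc (star_groupoid Y) (star e) = fs_proj x)
      (e2 : gsrc g = @fs_proj _ (fs_comp (gso_fs X)) x),
      act (Phi X) e1 = act (gso_act X) e2.
Proof.
exists (@star_action G Y); split; first exact: star_action_bijective.
by move=> X g y x e e1 e2; exact: (action_eq (gso_act X)).
Qed.
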